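(* Let $n\ge2$, $t\ge 1$, $\mathbf w\in\Delta_n^+$, and let $(U_1,\dots,U_n)$ have joint distribution $\mathrm{Clayton}(t)$. If $r\ge t$, then $M^{\mathbf w}_{-r}(U_1,\dots,U_n)$ is strictly sub-uniform. Moreover, for $p\in(0,1)$ and $s\in[1,t]$, $$\mathbb P\left(M^{\mathbf w}_{-s}(U_1,\dots,U_n)\le p\right)\le G_{1/t}\left(\frac{1}{p^{-t}-1}\right),$$ where $G_{1/t}$ is the cumulative distribution function of a Gamma distribution with parameter $(1/t,1)$. In particular, $$\mathbb P\left(M^{\mathbf w}_{-1}(U_1,\dots,U_n)\le p\right)\le \sup_{b\ge 1}G_{1/b}\left(\frac{1}{p^{-b}-1}\right).$$
   Context: $\Delta_n=\{(w_1,\dots,w_n)\in[0,1]^n: w_1+\dots+w_n=1\}$ and $\Delta_n^+=\Delta_n\cap(0,1)^n$. For $r\in\mathbb R\setminus\{0\}$ and $\mathbf w=(w_1,\dots,w_n)\in\Delta_n$, the weighted $r$-mean is $M^{\mathbf w}_r(u_1,\dots,u_n)=(w_1u_1^r+\dots+w_nu_n^r)^{1/r}$ for $(u_1,\dots,u_n)\in(0,\infty)^n$. A non-negative random variable $X$ is strictly sub-uniform if $\mathbb P(X\le p)>p$ for all $p\in(0,1)$. For $t>0$, $\mathrm{Clayton}(t)$ is the copula (joint distribution function with uniform margins on $(0,1)$) given by $C(u_1,\dots,u_n)=\left(u_1^{-t}+\dots+u_n^{-t}-(n-1)\right)^{-1/t}$ for $(u_1,\dots,u_n)\in(0,1)^n$.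 The Gamma distribution with parameter $(k,\theta)$, $k,\theta>0$, has distribution function $F(x)=(\Gamma(k)\theta^k)^{-1}\int_0^x y^{k-1}e^{-y/\theta}\,\mathrm dy$, $x\ge0$; $G_{1/b}$ is the distribution function of the Gamma distribution with parameter $(1/b,1)$. *)

(* Defs.v *)
From HB Require Import structures.
From mathcomp Require Import all_boot all_order all_algebra.
From mathcomp Require Import all_classical all_reals all_analysis.

Set Implicit Arguments.
Unset Strict Implicit.
Unset Printing Implicit Defensive.

Import Order.TTheory GRing.Theory Num.Theory.
Import numFieldNormedType.Exports.

Local Open Scope classical_set_scope.
Local Open Scope ring_scope.

Definition simplex (R : realType) (n : nat) : set ('I_n -> R) :=
  [set w | (forall i, 0 <= w i <= 1) /\ \sum_(i < n) w i = 1].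

Definition open_simplex (R : realType) (n : nat) : set ('I_n -> R) :=
  @simplex R n `&` [set w | forall i, 0 < w i < 1].

(* Meant for r != 0 and for positive entries u i; outside this domain the value
   is the one given by the conventions of [powR]. *)
Definition weighted_mean (R : realType) (n : nat) (w : 'I_n -> R) (r : R)
    (u : 'I_n -> R) : R :=
  (\sum_(i < n) w i * u i `^ r) `^ r^-1.

Definition strictly_subuniform d (T : measurableType d) (R : realType)
    (P : probability T R) (X : T -> R) : Prop :=
  [/\ measurable_fun [set: T] X,
      forall x, 0 <= X x
    & forall p : R, 0 < p < 1 -> (p%:E < P [set x | (X x <= p)%R])%E].

Definition clayton (R : realType) (n : nat) (t : R) (u : 'I_n -> R) : R :=
  (\sum_(i < n) u i `^ (- t) - (n%:R - 1)) `^ (- t^-1).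

(* The formula of a copula is only given on (0,1)^n.  Since the margins are
   uniform on (0,1), this determines the law of (U_1,...,U_n).
   The margins are compared on measurable sets because the value of a measure
   on other sets is unspecified. *)
Definition has_copula d (T : measurableType d) (R : realType)
    (P : probability T R) (n : nat) (C : ('I_n -> R) -> R)
    (U : 'I_n -> {RV P >-> R}) : Prop :=
  (forall i (A : set R), measurable A ->
     distribution P (U i) A = uniform_prob (@ltr01 R) A) /\
  (forall u : 'I_n -> R, (forall i, 0 < u i < 1) ->
     P [set x | forall i, (U i x <= u i)%R] = (C u)%:E).

Definition gamma_fun (R : realType) (k : R) : R :=
  \int[@lebesgue_measure R]_(y in `]0, +oo[) (y `^ (k - 1) * expR (- y)).

Definition gamma_cdf (R : realType) (k theta x : R) : \bar R :=
  (((gamma_fun k * theta `^ k)^-1)%:E *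
   \int[@lebesgue_measure R]_(y in `]0%R, x])
      (y `^ (k - 1) * expR (- (y / theta)))%:E)%E.

(* Main.v *)
Require Import Defs.
From HB Require Import structures.
From mathcomp Require Import all_boot all_order all_algebra.
From mathcomp Require Import all_classical all_reals all_analysis.
From mathcomp Require Import measurable_realfun.
From mathcomp Require Import ring lra.

(** The proof rests on the frailty representation of the Clayton copula. Let
    [E_1, ..., E_n] be independent standard exponential variables and [g] an
    independent Gamma variable of parameter [(1/t, 1)]. Conditionally on [g] the
    vector [V_i = E_i / g] has tail [exp (- g * (v_1 + ... + v_n))], so its tail
    is the Laplace transform [(1 + v_1 + ... + v_n) ^ (- 1/t)] of the Gamma law
    ([gamma_law_laplace]). This is also the tail of the vector of the
    [U_i ^ (- t) - 1]; joint tails determine joint laws ([joint_law_unique]), so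
    the two vectors have the same law. Writing [F] for the distribution function
    of [g], one gets for all coefficients [c] and all [x > 0]
    ([clayton_frailty])
      [P (x <= \sum_i c_i (U_i ^ (- t) - 1)) = 'E [F (\sum_i c_i E_i / x)]].

    The event that the mean of exponent [- t] is at most [p] is the event
    [p ^ (- t) - 1 <= \sum_i w_i (U_i ^ (- t) - 1)], whence its probability is
    ['E [F (S / x)]] with [S = \sum_i w_i E_i] and [x = p ^ (- t) - 1]. Since
    [t >= 1], the Gamma density decreases strictly, so [F] is strictly concave
    on the positive half-line, and Jensen's inequality can be used twice.
    - In the space of indices: [F (S / x) >= \sum_i w_i F (E_i / x)], strictly
      unless all [E_i] coincide. Each ['E [F (E_i / x)]] is [P (U_i <= p) = p]
      by the representation itself, whence the strict sub-uniformity
      ([prob_mean_gt]).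
    - In the probability space: ['E [F (S / x)] <= F ('E [S] / x) = F (1 / x)],
      which is the Gamma bound ([prob_mean_le]).
    Both are obtained from tangent lines of [F] ([gamma_law_cdf_tangent_lt]).

    Power means of exponent [- r] decrease with [r] ([weighted_mean_nincr]),
    which carries the first inequality from [t] to [r >= t] and the second one
    from [t] to [s <= t]. The bound for the harmonic mean is the case [s = 1],
    the supremum being bounded below by its value at [b = t]. *)

Set Implicit Arguments.
Unset Strict Implicit.
Unset Printing Implicit Defensive.

Import Order.TTheory GRing.Theory Num.Theory.
Import numFieldNormedType.Exports.

Local Open Scope classical_set_scope.
Local Open Scope ring_scope.

(** * Measures, integrals and powers *)

Lemma le_measure_off_null d (T : measurableType d) (R : realType)
    (mu : {measure set T -> \bar R}) (A B N : set T) :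
  measurable A -> measurable B -> measurable N -> mu N = 0 ->
  A `\` N `<=` B -> (mu A <= mu B)%E.
Proof.
move=> mA mB mN N0 AB; rewrite -(measureU0 mB mN N0).
apply: le_measure; rewrite ?inE//; first exact: measurableU.
by move=> x Ax; have [Nx|Nx] := pselect (N x); [right|left; exact: AB].
Qed.

Lemma eq_measure_off_null d (T : measurableType d) (R : realType)
    (mu : {measure set T -> \bar R}) (A B N : set T) :
  measurable A -> measurable B -> measurable N -> mu N = 0 ->
  (forall x, ~ N x -> A x <-> B x) -> mu A = mu B.
Proof.
move=> mA mB mN N0 AB; apply/le_anti/andP; split.
- by apply: (le_measure_off_null mA mB mN N0) => x [Ax /AB[ABx _]]; exact: ABx.
- by apply: (le_measure_off_null mB mA mN N0) => x [Bx /AB[_ BAx]]; exact: BAx.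
Qed.

Lemma measurable_superlevel d (T : measurableType d) (R : realType) (f : T -> R)
  (a : R) : measurable_fun setT f -> measurable [set x | a <= f x].
Proof.
move=> mf; rewrite -[X in measurable X]setTI.
rewrite (_ : [set x | _] = f @^-1` `[a, +oo[%classic); first exact: mf.
by apply/seteqP; split => x /=; rewrite in_itv/= andbT.
Qed.

Lemma measurable_sublevel d (T : measurableType d) (R : realType) (f : T -> R)
  (a : R) : measurable_fun setT f -> measurable [set x | f x <= a].
Proof.
move=> mf; rewrite -[X in measurable X]setTI.
rewrite (_ : [set x | _] = f @^-1` `]-oo, a]%classic); first exact: mf.
by apply/seteqP; split => x /=; rewrite in_itv/=.
Qed.

Lemma measurable_upper_box d (T : measurableType d) (R : realType) n
    (X : 'I_n -> T -> R) (a : 'I_n -> R) : (forall i, measurable_fun setT (X i)) ->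
  measurable [set x | forall i, a i <= X i x].
Proof.
move=> mX; rewrite (_ : [set x | _] =
  \bigcap_(i in [set: 'I_n]) [set x | a i <= X i x]).
  by apply: fin_bigcap_measurable => [|i _];
    [exact: finite_finset|exact: measurable_superlevel].
by apply/seteqP; split => x /= h i; [move=> _; exact: h|exact: h].
Qed.

(** If the integrals agreed, the nonnegative difference would have integral
    zero and so vanish almost everywhere. *)
Lemma lt_integral d (T : measurableType d) (R : realType)
    (mu : {measure set T -> \bar R}) (f g : T -> R) :
  measurable_fun setT f -> measurable_fun setT g ->
  (forall x, 0 <= f x) -> (forall x, f x <= g x) ->
  (\int[mu]_x (f x)%:E < +oo)%E -> ~ {ae mu, forall x, f x = g x} ->
  (\int[mu]_x (f x)%:E < \int[mu]_x (g x)%:E)%E.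
Proof.
move=> mf mg f0 fg fy nae.
have mgf : measurable_fun setT (fun x => g x - f x) by exact: measurable_funB.
have gE : (\int[mu]_x (g x)%:E =
    \int[mu]_x (f x)%:E + \int[mu]_x (g x - f x)%:E)%E.
  rewrite -ge0_integralD//.
  - by apply: eq_integral => x _; rewrite -EFinD addrC subrK.
  - by move=> x _; rewrite lee_fin.
  - exact/measurable_EFinP.
  - by move=> x _; rewrite lee_fin subr_ge0.
  - exact/measurable_EFinP.
rewrite gE lteDl; last first.
  by rewrite ge0_fin_numE// integral_ge0// => x _; rewrite lee_fin.
rewrite lt_neqAle; apply/andP; split; last first.
  by apply: integral_ge0 => x _; rewrite lee_fin subr_ge0.
apply/negP => /eqP int0; apply: nae.
have : (\int[mu]_x `|(g x - f x)%:E| = 0)%E.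
  rewrite [RHS]int0; apply: eq_integral => x _.
  by rewrite gee0_abs// lee_fin subr_ge0.
have mE : measurable_fun setT (EFin \o (fun x => g x - f x)).
  exact/measurable_EFinP.
move/(ae_eq_integral_abs mu measurableT mE).
apply: filterS => x /(_ I) [/eqP].
by rewrite subr_eq0 => /eqP.
Qed.

(** Both sides are measures of [A], so that a comparison on half-open
    intervals is enough. *)
Lemma lebesgue_measure_scale (R : realType) (c : R) (A : set R) : 0 < c ->
  measurable A ->
  (@lebesgue_measure R A =
   c%:E * @lebesgue_measure R ((fun x => (c * x)%R : measurableTypeR R) @^-1` A))%E.
Proof.
move=> c0 mA; pose phi (x : measurableTypeR R) : measurableTypeR R := c * x.
have mphi : measurable_fun setT phi by exact: measurable_funM.
have c0' : 0 <= c by exact: ltW.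
apply: (@lebesgue_measure_unique R
  (mscale (NngNum c0') (pushforward (@lebesgue_measure R) phi))) => //.
move=> _ [[a b]] _ <-.
have phiE : phi @^-1` [set` Interval (BRight a) (BRight b)] =
    [set` Interval (BRight (a / c)) (BRight (b / c))].
  apply/seteqP; split => x /=; rewrite !in_itv/= /phi;
  by rewrite ltr_pdivrMr// ler_pdivlMr// ![c * x]mulrC.
transitivity (c%:E * @lebesgue_measure R
  (phi @^-1` [set` Interval (BRight a) (BRight b)]))%E; last by [].
rewrite phiE !lebesgue_measure_itv/= !lte_fin ltr_pM2r ?invr_gt0//.
case: ifPn => _; last by rewrite mule0.
by rewrite -EFinB -EFinM; congr EFin; field; rewrite gt_eqF.
Qed.

Lemma ge0_integral_scale (R : realType) (c : R) (f : R -> \bar R) : 0 < c ->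
  measurable_fun [set: R] f -> (forall x, 0 <= f x)%E ->
  (\int[@lebesgue_measure R]_(x in `]0%R, +oo[) f x =
   c%:E * \int[@lebesgue_measure R]_(x in `]0%R, +oo[) f (c * x)%R)%E.
Proof.
move=> c0 mf f0; pose phi (x : measurableTypeR R) : measurableTypeR R := c * x.
have mphi : measurable_fun setT phi by exact: measurable_funM.
have c0' : 0 <= c by exact: ltW.
have phiD : phi @^-1` `]0%R, +oo[%classic = `]0%R, +oo[%classic.
  by apply/seteqP; split => x /=; rewrite !in_itv/= /phi !andbT pmulr_rgt0.
rewrite -[in RHS]phiD.
rewrite -(@ge0_integral_pushforward _ _ _ _ _ _ mphi _ `]0%R, +oo[%classic f)//;
  last exact: measurable_funTS.
rewrite -(ge0_integral_mscale _ _ (NngNum c0'))//; last exact: measurable_funTS.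
apply: eq_measure_integral => A mA _.
exact: lebesgue_measure_scale.
Qed.

Section density.
Import HBNNSimple.

(** For indicators this is the hypothesis on [nu]; it extends to simple
    functions by linearity and to nonnegative ones by monotone convergence. *)
Lemma ge0_integral_density d (T : measurableType d) (R : realType)
    (mu nu : {measure set T -> \bar R}) (g : T -> R) :
  measurable_fun setT g -> (forall x, 0 <= g x)%R ->
  (forall A, measurable A -> nu A = \int[mu]_(x in A) (g x)%:E)%E ->
  forall f : T -> \bar R, measurable_fun setT f -> (forall x, 0 <= f x)%E ->
  (\int[nu]_x f x = \int[mu]_x (f x * (g x)%:E))%E.
Proof.
move=> mg g0 nuE f mf f0.
pose f_ := nnsfun_approx measurableT mf.
have mf_ n : measurable_fun setT (fun x => (f_ n x)%:E).
  exact/measurable_EFinP/measurable_funTS.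
have mg_ : measurable_fun setT (fun x => (g x)%:E) by exact/measurable_EFinP.
transitivity (lim (\int[nu]_x (f_ n x)%:E @[n --> \oo])%E).
  rewrite -monotone_convergence//=.
  - apply: eq_integral => ? /[!inE] xD; apply/esym/cvg_lim => //=.
    exact: cvg_nnsfun_approx.
  - by move=> n ? _; rewrite lee_fin.
  - by move=> ? _ ? ? mn; rewrite lee_fin; exact/lefP/nd_nnsfun_approx.
transitivity (lim (\int[mu]_x ((f_ n x)%:E * (g x)%:E) @[n --> \oo])%E); last first.
  rewrite -monotone_convergence//=.
  - apply: eq_integral => x /[!inE] xD; apply/cvg_lim => //=.
    apply: cvgeZr => //.
    exact: cvg_nnsfun_approx.
  - by move=> n; exact: emeasurable_funM.
  - by move=> n ? _; rewrite mule_ge0// lee_fin.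
  - move=> ? _ ? ? mn; rewrite lee_wpmul2r ?lee_fin//.
    exact/lefP/nd_nnsfun_approx.
apply: congr_lim; apply/funext => n.
under eq_integral do rewrite fimfunE -fsumEFin//.
rewrite ge0_integral_fsum//; last 2 first.
  - by move=> r; exact/measurable_EFinP/measurable_funM.
  - by move=> r x _; rewrite EFinM nnfun_muleindic_ge0.
under [RHS]eq_integral.
  move=> x _; rewrite fimfunE -fsumEFin// ge0_mule_fsuml; last first.
    by move=> r; rewrite EFinM nnfun_muleindic_ge0.
  over.
rewrite [RHS]ge0_integral_fsum//; last 2 first.
  - move=> r; apply: emeasurable_funM => //.
    exact/measurable_EFinP/measurable_funM.
  - move=> r x _; rewrite mule_ge0 ?lee_fin// -lee_fin EFinM.
    exact: nnfun_muleindic_ge0.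
apply: eq_fsbigr => r _.
rewrite integralZl_indic_nnsfun//= integral_indic// setIT nuE//.
under [RHS]eq_integral do rewrite EFinM -muleA.
have [r0|r0] := leP 0 r; last first.
  by rewrite preimage_nnfun0// integral_set0 mule0 integral0_eq// => x _;
    rewrite indic0 mul0e mule0.
rewrite ge0_integralZl//; last 2 first.
  - by apply: emeasurable_funM => //; exact/measurable_EFinP.
  - by move=> x _; rewrite mule_ge0// lee_fin.
congr (_ * _)%E; rewrite integral_mkcond; apply: eq_integral => x _.
by rewrite patchE indicE; case: ifPn => _; rewrite ?mul1e ?mul0e.
Qed.

End density.

Lemma ler_powR_base (R : realType) (t x y : R) : 0 < t -> 0 < x -> 0 < y ->
  (x `^ t <= y `^ t) = (x <= y).
Proof.
move=> t0 x0 y0; apply/idP/idP => h; last first.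
  by apply: (ge0_ler_powR (ltW t0)) => //; rewrite nnegrE ltW.
rewrite leNgt; apply/negP => yx.
have := gt0_ltr_powR t0 _ _ yx; rewrite !nnegrE !ltW// => /(_ isT isT).
by rewrite ltNge h.
Qed.

Lemma powRN_gt1 (R : realType) (t u : R) : 0 < t -> 0 < u < 1 -> 1 < u `^ (- t).
Proof.
move=> t0 /andP[u0 u1]; rewrite powRN invf_gt1 ?powR_gt0//.
have := ler_powR_base t0 ltr01 u0.
by rewrite powR1 !leNgt => /negb_inj ->.
Qed.

Lemma weighted_sum_gt0 (R : realType) n (w a : 'I_n -> R) : (0 < n)%N ->
  (forall i, 0 < w i) -> (forall i, 0 < a i) -> 0 < \sum_i w i * a i.
Proof.
move=> n0 w0 a0; rewrite (bigD1 (Ordinal n0))//= ltr_pwDl ?mulr_gt0//.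
by rewrite sumr_ge0// => i _; rewrite ltW// mulr_gt0.
Qed.

(** * Weighted power means *)

Section power_means.
Context {R : realType} (n : nat) (w : 'I_n -> R).
Hypotheses (n0 : (0 < n)%N) (w0 : forall i, 0 < w i) (w1 : \sum_i w i = 1).

(** Jensen's inequality for the power [q], deduced from Young's inequality [a
    * b <= a ^ q / q + b ^ q' / q'] between each [a i] and [b = s ^ (q - 1)],
    where [s] is the mean: since [b ^ q' = s ^ q], the weighted sum of these
    inequalities is the claim up to the factor [1 / q]. *)
Lemma powR_weighted_sum_le (a : 'I_n -> R) (q : R) :
  (forall i, 0 < a i) -> 1 <= q ->
  (\sum_i w i * a i) `^ q <= \sum_i w i * a i `^ q.
Proof.
move=> a0; rewrite le_eqVlt => /predU1P[<-|q1].
  rewrite powRr1 ?(ltW (weighted_sum_gt0 n0 w0 a0))//.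
  by apply: ler_sum => i _; rewrite powRr1// ltW.
set s := \sum_i w i * a i; have s0 : 0 < s by exact: weighted_sum_gt0.
have q0 : 0 < q by exact: lt_trans q1.
pose q' := q / (q - 1).
have qB1 : 0 < q - 1 by rewrite subr_gt0.
have q'0 : 0 < q' by rewrite divr_gt0.
have qq' : q^-1 + q'^-1 = 1.
  by rewrite /q' invf_div; field; rewrite gt_eqF.
have young i : w i * (a i * s `^ (q - 1)) <=
    w i * (a i `^ q / q + s `^ q / q').
  rewrite ler_pM2l//; apply: le_trans (conjugate_powR _ _ q0 q'0 qq') _.
  - exact: ltW.
  - exact: powR_ge0.
  rewrite -powRrM [_ * q'](_ : _ = q)//.
  by rewrite /q'; field; rewrite gt_eqF.
have sumE : \sum_i w i * (a i * s `^ (q - 1)) = s `^ q.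
  under eq_bigr do rewrite mulrA.
  by rewrite -mulr_suml mulr_powRB1// ltW.
have : s `^ q <= \sum_i w i * (a i `^ q / q + s `^ q / q').
  by rewrite -[leLHS]sumE; exact: ler_sum.
under eq_bigr do rewrite mulrDr mulrA.
rewrite big_split/= -!mulr_suml w1 mul1r => h.
have -> : s `^ q = q * (s `^ q - s `^ q / q').
  have -> : q'^-1 = 1 - q^-1 by rewrite -qq' addrC addKr.
  by field; rewrite gt_eqF.
by rewrite -ler_pdivlMl// lerBlDr mulrC.
Qed.

(** The numbers [u i ^ (- r)] are the powers of exponent [r / s >= 1] of the
    [u i ^ (- s)], and the outer exponent is negative, which reverses Jensen's
    inequality. *)
Lemma weighted_mean_nincr (u : 'I_n -> R) (s r : R) :
  (forall i, 0 < u i) -> 0 < s -> s <= r ->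
  weighted_mean w (- r) u <= weighted_mean w (- s) u.
Proof.
move=> u0 s0 sr; have r0 := lt_le_trans s0 sr; rewrite /weighted_mean.
pose a i := u i `^ (- s).
have a0 i : 0 < a i by rewrite powR_gt0.
have aq i : u i `^ (- r) = a i `^ (r / s).
  by rewrite /a -powRrM; congr (_ `^ _); field; rewrite gt_eqF.
under eq_bigr do rewrite aq.
set S := \sum_i w i * u i `^ (- s).
have S0 : 0 < S by exact: weighted_sum_gt0.
have -> : S `^ (- s)^-1 = (S `^ (r / s)) `^ (- r)^-1.
  by rewrite -powRrM; congr (_ `^ _); field; rewrite !gt_eqF.
have T0 : 0 < \sum_i w i * a i `^ (r / s).
  by apply: weighted_sum_gt0 => // i; rewrite powR_gt0.
rewrite !invrN !powRN lef_pV2 ?posrE ?powR_gt0//.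
apply: ge0_ler_powR; rewrite ?nnegrE ?invr_ge0 ?powR_ge0 ?(ltW r0) ?(ltW T0)//.
by apply: powR_weighted_sum_le => //; rewrite ler_pdivlMr// mul1r.
Qed.

(** The form of the event to which the frailty representation applies; the
    constant 1 goes inside the sum because the weights sum to 1. *)
Lemma weighted_mean_le (u : 'I_n -> R) (t p : R) :
  (forall i, 0 < u i) -> 0 < t -> 0 < p ->
  (weighted_mean w (- t) u <= p) =
  (p `^ (- t) - 1 <= \sum_i w i * (u i `^ (- t) - 1)).
Proof.
move=> u0 t0 p0; rewrite /weighted_mean.
under [in RHS]eq_bigr do rewrite mulrBr mulr1.
rewrite sumrB w1 lerD2r; set S := \sum_i _.
have S0 : 0 < S by apply: weighted_sum_gt0 => // i; rewrite powR_gt0.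
have SE : S = (S `^ (- t)^-1) `^ (- t).
  by rewrite -powRrM mulVf ?powRr1 ?(ltW S0)// oppr_eq0 gt_eqF.
rewrite [in RHS]SE.
have M0 : 0 < S `^ (- t)^-1 by rewrite powR_gt0.
move: M0; set M := S `^ _ => M0.
by rewrite !powRN lef_pV2 ?posrE ?powR_gt0// ler_powR_base.
Qed.

End power_means.

(** * The Gamma law of shape at most one *)

Section gamma_kernel.
Context {R : realType}.
Notation mu := (@lebesgue_measure R).
Implicit Types (k x y : R).

Definition gamma_kernel k y := y `^ (k - 1) * expR (- y).

Lemma measurable_gamma_kernel k : measurable_fun setT (gamma_kernel k).
Proof.
by apply: measurable_funM; [exact: measurable_powR|exact: measurableT_comp].
Qed.

Lemma gamma_kernel_ge0 k y : 0 <= gamma_kernel k y.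
Proof. by rewrite mulr_ge0 ?powR_ge0 ?expR_ge0. Qed.

(** For [k < 1] the integrand is unbounded at 0: the fundamental theorem of
    calculus is applied on the intervals from [1 / (n + 2)] to 1, and [n]
    tends to infinity. *)
Lemma integral_powRB1_le k : 0 < k ->
  (\int[mu]_(x in `]0%R, 1%R]) (x `^ (k - 1))%:E <= (k^-1)%:E)%E.
Proof.
move=> k0; pose F (n : nat) : set R := `[(n.+2%:R)^-1, 1]%classic.
have n1 n : (n.+2%:R^-1 < 1 :> R) by rewrite invf_lt1// ltr1n.
have n0 n : (0 < n.+2%:R^-1 :> R) by rewrite invr_gt0.
have -> : `]0%R, 1%R]%classic = \bigcup_n F n.
  apply/seteqP; split => [x /=|x [n _]].
    rewrite in_itv/= => /andP[x0 x1]; exists (Num.truncn x^-1) => //.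
    rewrite /F /= in_itv/= x1 andbT.
    rewrite -[leRHS]invrK lef_pV2 ?posrE ?invr_gt0//.
    by apply/ltW/(lt_le_trans (truncnS_gt _)); rewrite ler_nat.
  by rewrite /F /= !in_itv/= => /andP[xn ->]; rewrite andbT (lt_le_trans _ xn).
have mpow : measurable_fun setT (fun x : R => (x `^ (k - 1))%:E).
  by apply/measurable_EFinP; exact: measurable_powR.
have Fcvg : (\int[mu]_(x in F i) (x `^ (k - 1))%:E @[i --> \oo] -->
    \int[mu]_(x in \bigcup_i F i) (x `^ (k - 1))%:E)%E.
  apply: ge0_nondecreasing_set_cvg_integral => //.
  - apply/nondecreasing_seqP => n; rewrite subsetEset /F => x /=.
    rewrite !in_itv/= => /andP[xn ->]; rewrite andbT (le_trans _ xn)//.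
    by rewrite lef_pV2 ?posrE// ler_nat.
  - by move=> n; exact: measurable_itv.
  - by move=> n; exact: measurable_funTS.
  - by move=> n x _; rewrite lee_fin powR_ge0.
rewrite -(cvg_lim _ Fcvg)//; apply: lime_le.
  by apply/cvg_ex; eexists; exact: Fcvg.
apply: nearW => n; rewrite /F.
have cpow c x : 0 < x -> {for x, continuous (fun y : R => y `^ c)}.
  move=> x0; apply/differentiable_continuous/derivable1_diffP.
  by apply: derivable_powR; rewrite in_itv/= x0.
have cF c x : 0 < x -> {for x, continuous (fun y : R => k^-1 * y `^ c)}.
  by move=> x0; apply: continuousM; [exact: cst_continuous|exact: cpow].
rewrite (@continuous_FTC2 _ _ (fun y => k^-1 * y `^ k))//.
- rewrite powR1 mulr1 -EFinB lee_fin lerBlDr lerDl.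
  by rewrite mulr_ge0 ?powR_ge0// invr_ge0 ltW.
- apply: continuous_in_subspaceT => x /set_mem/=; rewrite in_itv/= => /andP[xn _].
  by apply: cpow; exact: lt_le_trans xn.
- split.
  + move=> x; rewrite in_itv/= => /andP[xn _].
    apply: derivableM => //; apply: derivable_powR.
    by rewrite in_itv/= andbT (lt_trans _ xn).
  + by apply/cvg_at_right_filter; exact: cF.
  + by apply/cvg_at_left_filter; exact: cF.
- move=> x; rewrite in_itv/= => /andP[xn _].
  have x0 : 0 < x by exact: lt_trans xn.
  rewrite derive1Ml; last by apply: derivable_powR; rewrite in_itv/= x0.
  rewrite powR_derive1 ?in_itv/= ?x0//.
  by rewrite mulrA mulVf ?mul1r// gt_eqF.
Qed.

Lemma integral_expRN1y_le : (\int[mu]_(x in `]1%R, +oo[) (expR (- x))%:E <= 1)%E.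
Proof.
have r1 : 0 < (1 : R) by exact: ltr01.
rewrite -(integral_exponential_pdf r1).
have mpdf : measurable_fun setT (EFin \o exponential_pdf (1 : R)).
  by apply/measurable_EFinP; exact: measurable_exponential_pdf.
rewrite (_ : (\int[mu]_(x in _) _ =
    \int[mu]_(x in `]1%R, +oo[) (exponential_pdf 1 x)%:E)%E).
  apply: ge0_subset_integral => //=.
  by move=> x _; rewrite lee_fin exponential_pdf_ge0.
apply: eq_integral => x; rewrite inE/= in_itv/= andbT => x1.
by rewrite exponential_pdfE ?mul1r ?mulN1r// (le_trans _ (ltW x1)).
Qed.

(** The power is integrable on the left of 1, where the exponential is at most
    1; on the right of 1 the power is at most 1, because [k <= 1]. *)
Lemma integral_gamma_kernel_fin k : 0 < k -> k <= 1 ->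
  (\int[mu]_(x in `]0%R, +oo[) (gamma_kernel k x)%:E < +oo)%E.
Proof.
move=> k0 k1.
have mk : measurable_fun setT (EFin \o gamma_kernel k).
  by apply/measurable_EFinP; exact: measurable_gamma_kernel.
have me : measurable_fun setT (fun x : R => (expR (- x))%:E).
  by apply/measurable_EFinP; exact: measurableT_comp.
have mp : measurable_fun setT (fun x : R => (x `^ (k - 1))%:E).
  by apply/measurable_EFinP; exact: measurable_powR.
rewrite (_ : `]0%R, +oo[%classic = `]0%R, 1%R] `|` `]1%R, +oo[); last first.
  apply/seteqP; split => x /=; rewrite !in_itv/= !andbT.
    by move=> x0; case: (leP x 1) => x1; [left; rewrite x0|right].
  by move=> [/andP[]//|]; apply: lt_trans.
rewrite ge0_integral_setU//=; last 3 first.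
  - exact: measurable_funTS.
  - by move=> x _; rewrite lee_fin gamma_kernel_ge0.
  - apply/disj_setPS => x [/=]; rewrite !in_itv/= andbT.
    by move=> /andP[_ /le_lt_trans/[apply]]; rewrite ltxx.
apply: (@le_lt_trans _ _ ((k^-1)%:E + 1)%E); last by rewrite -EFinD ltry.
apply: leeD.
  apply: le_trans (integral_powRB1_le k0); apply: ge0_le_integral => //=.
  - by move=> x _; rewrite lee_fin gamma_kernel_ge0.
  - exact: measurable_funTS.
  - exact: measurable_funTS.
  - move=> x; rewrite in_itv/= => /andP[x0 _]; rewrite lee_fin /gamma_kernel.
    by rewrite ler_piMr ?powR_ge0// -expR0 ler_expR oppr_le0 ltW.
apply: le_trans integral_expRN1y_le; apply: ge0_le_integral => //=.
- by move=> x _; rewrite lee_fin gamma_kernel_ge0.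
- exact: measurable_funTS.
- exact: measurable_funTS.
- move=> x; rewrite in_itv/= andbT => x1; rewrite lee_fin /gamma_kernel.
  rewrite ler_piMl ?expR_ge0// -[leRHS](powRr0 x).
  by apply: ler_powR; [exact: ltW|rewrite subr_le0].
Qed.

Lemma integral_gamma_kernel_gt0 k : k <= 1 ->
  (0 < \int[mu]_(x in `]0%R, +oo[) (gamma_kernel k x)%:E)%E.
Proof.
move=> k1.
have mk : measurable_fun setT (EFin \o gamma_kernel k).
  by apply/measurable_EFinP; exact: measurable_gamma_kernel.
apply: (@lt_le_trans _ _ (\int[mu]_(x in `]0%R, 1%R]) (cst (expR (-1))%:E) x)%E).
  rewrite integral_cst//= lebesgue_measure_itv/= lte_fin ltr01 sube0 mule1.
  by rewrite lte_fin expR_gt0.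
apply: (@le_trans _ _ (\int[mu]_(x in `]0%R, 1%R]) (gamma_kernel k x)%:E)%E).
  apply: ge0_le_integral => //=.
  - exact: measurable_funTS.
  - move=> x; rewrite in_itv/= => /andP[x0 x1]; rewrite lee_fin /gamma_kernel.
    rewrite -[leLHS]mul1r ler_pM ?expR_ge0// ?ler_expR ?lerN2//.
    rewrite -[leLHS](powRr0 x); apply: ger_powR; first by rewrite x0.
    by rewrite subr_le0.
apply: ge0_subset_integral => //=.
- exact: measurable_funTS.
- by move=> x _; rewrite lee_fin gamma_kernel_ge0.
- by move=> x /=; rewrite !in_itv/= andbT => /andP[].
Qed.

Lemma gamma_funE k : 0 < k -> k <= 1 ->
  (gamma_fun k)%:E = (\int[mu]_(x in `]0%R, +oo[) (gamma_kernel k x)%:E)%E.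
Proof.
move=> k0 k1; rewrite /gamma_fun /Rintegral fineK// ge0_fin_numE.
  exact: integral_gamma_kernel_fin.
by apply: integral_ge0 => x _; rewrite lee_fin gamma_kernel_ge0.
Qed.

Lemma gamma_fun_gt0 k : 0 < k -> k <= 1 -> 0 < gamma_fun k.
Proof.
by move=> k0 k1; rewrite -lte_fin gamma_funE// integral_gamma_kernel_gt0.
Qed.

End gamma_kernel.

Section gamma_law.
Context {R : realType}.
Notation mu := (@lebesgue_measure R).
Implicit Types (k x y : R).

Definition gamma_density k : R -> R :=
  (fun y => (gamma_fun k)^-1 * gamma_kernel k y) \_ `]0, +oo[.

(** The law is characterized by its values instead of being a function of [k],
    so that statements about it need not carry the proof that the density has
    integral one. *)
Definition gamma_law k (G : probability (measurableTypeR R) R) :=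
  forall A, measurable A -> (G A = \int[mu]_(y in A) (gamma_density k y)%:E)%E.

Lemma measurable_gamma_density k : measurable_fun setT (gamma_density k).
Proof.
apply/(measurable_restrictT _ _).1 => //; apply: measurable_funTS.
by apply: measurable_funM => //; exact: measurable_gamma_kernel.
Qed.

Lemma gamma_density_gt0E k y : 0 < y ->
  gamma_density k y = (gamma_fun k)^-1 * gamma_kernel k y.
Proof. by move=> y0; rewrite /gamma_density patchE mem_set//= in_itv/= y0. Qed.

Lemma gamma_density_le0E k y : y <= 0 -> gamma_density k y = 0.
Proof.
by move=> y0; rewrite /gamma_density patchE memNset//= in_itv/= andbT ltNge y0.
Qed.

Lemma gamma_density_ge0 k y : 0 < k -> k <= 1 -> 0 <= gamma_density k y.
Proof.
move=> k0 k1; have [y0|y0] := leP y 0; first by rewrite gamma_density_le0E.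
rewrite gamma_density_gt0E// mulr_ge0 ?gamma_kernel_ge0// invr_ge0 ltW//.
exact: gamma_fun_gt0.
Qed.

Lemma integral_gamma_density (f : R -> \bar R) k : 0 < k -> k <= 1 ->
  measurable_fun setT f -> (forall y, 0 <= f y)%E ->
  (\int[mu]_y (f y * (gamma_density k y)%:E) =
   ((gamma_fun k)^-1)%:E *
   \int[mu]_(y in `]0%R, +oo[) (f y * (gamma_kernel k y)%:E))%E.
Proof.
move=> k0 k1 mf f0.
have G0 : 0 <= (gamma_fun k)^-1 by rewrite invr_ge0 ltW// gamma_fun_gt0.
have mk : measurable_fun setT (EFin \o gamma_kernel k).
  by apply/measurable_EFinP; exact: measurable_gamma_kernel.
rewrite -ge0_integralZl//=; last 2 first.
- by apply: measurable_funTS; exact: emeasurable_funM.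
- by move=> x _; rewrite mule_ge0// lee_fin gamma_kernel_ge0.
rewrite [RHS]integral_mkcond; apply: eq_integral => y _.
rewrite /gamma_density !patchE; case: ifPn => _; last by rewrite mule0.
by rewrite EFinM muleCA.
Qed.

Lemma gamma_law_exists k : 0 < k -> k <= 1 -> exists G, gamma_law k G.
Proof.
move=> k0 k1.
pose G A := (\int[mu]_(y in A) (gamma_density k y)%:E)%E.
have md : measurable_fun setT (EFin \o gamma_density k).
  by apply/measurable_EFinP; exact: measurable_gamma_density.
have G0 : G set0 = 0%E by rewrite /G integral_set0.
have Gge0 A : (0 <= G A)%E.
  by apply: integral_ge0 => y _; rewrite lee_fin gamma_density_ge0.
have Gsigma : semi_sigma_additive G.
  move=> /= F mF tF mUF; rewrite /G; apply: cvg_toP.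
    apply: ereal_nondecreasing_is_cvgn => m n mn.
    by apply: lee_sum_nneg_natr => // i _ _; exact: Gge0.
  rewrite ge0_integral_bigcup//=.
  - exact: measurable_funTS.
  - by move=> x _; rewrite lee_fin gamma_density_ge0.
have GT : G [set: R] = 1%E.
  transitivity (\int[mu]_y (cst 1%E y * (gamma_density k y)%:E))%E.
    by apply: eq_integral => y _; rewrite mul1e.
  rewrite integral_gamma_density//.
  under eq_integral do rewrite mul1e.
  by rewrite -gamma_funE// -EFinM mulVf// gt_eqF// gamma_fun_gt0.
pose m := isMeasure.Build _ (measurableTypeR R) R G G0 Gge0 Gsigma.
pose M : {measure set (measurableTypeR R) -> \bar R} := HB.pack G m.
pose m' := Measure_isProbability.Build _ _ _ M GT.
pose P : probability (measurableTypeR R) R := HB.pack G m m'.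
by exists P => A mA.
Qed.

Variables (k : R) (G : probability (measurableTypeR R) R).
Hypotheses (k0 : 0 < k) (k1 : k <= 1) (GE : gamma_law k G).

Lemma gamma_law_pos A : measurable A -> G A = G (A `&` `]0%R, +oo[).
Proof.
move=> mA; rewrite !GE//; last exact: measurableI.
rewrite integral_mkcond [RHS]integral_mkcond; apply: eq_integral => y _.
rewrite !patchE in_setI.
have [yA|] := boolP (y \in A) => //=.
case: ifPn => // /negP; rewrite inE/= in_itv/= andbT => /negP; rewrite -leNgt => y0.
by rewrite gamma_density_le0E.
Qed.

(** The substitution of [(1 + x) * y] for [y] in the integral that defines
    [gamma_fun k] takes out the factor [(1 + x) ^ k]. *)
Lemma gamma_law_laplace x : 0 <= x ->
  (\int[G]_y (expR (- (x * y)))%:E = ((1 + x) `^ (- k))%:E)%E.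
Proof.
move=> x0; have c0 : 0 < 1 + x by rewrite ltr_wpDr.
have mexp : measurable_fun setT (fun y : R => (expR (- (x * y)))%:E).
  apply/measurable_EFinP; apply: measurableT_comp => //.
  by apply: measurableT_comp => //; exact: measurable_funM.
have mk : measurable_fun setT (EFin \o gamma_kernel k).
  by apply/measurable_EFinP; exact: measurable_gamma_kernel.
rewrite (@ge0_integral_density _ (measurableTypeR R) R mu G _
  (measurable_gamma_density k) (fun y => gamma_density_ge0 y k0 k1) GE)//.
rewrite integral_gamma_density//.
set I := (\int[mu]_(y in _) _)%E.
have GI : ((gamma_fun k)%:E = ((1 + x) `^ k)%:E * I)%E.
  rewrite gamma_funE// (ge0_integral_scale c0)//; last first.
    by move=> y; rewrite lee_fin gamma_kernel_ge0.
  rewrite -(mulr_powRB1 (ltW c0) k0) EFinM -muleA; congr (_ * _)%E.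
  rewrite -ge0_integralZl//=; last 3 first.
  - by apply: measurable_funTS; exact: emeasurable_funM.
  - by move=> y _; rewrite mule_ge0// lee_fin ?expR_ge0 ?gamma_kernel_ge0.
  - by rewrite lee_fin powR_ge0.
  apply: eq_integral => y; rewrite inE/= in_itv/= andbT => y0.
  rewrite -!EFinM; congr EFin; rewrite /gamma_kernel powRM ?(ltW c0) ?(ltW y0)//.
  by rewrite mulrDl mul1r opprD expRD; ring.
have Ifin : I \is a fin_num.
  rewrite ge0_fin_numE; last first.
    apply: integral_ge0 => y _.
    by rewrite mule_ge0// lee_fin ?expR_ge0 ?gamma_kernel_ge0.
  have := ltry (gamma_fun k); rewrite GI; case: I {GI} => [r _| |]//; first exact: ltry.
  by rewrite mulry gtr0_sg ?powR_gt0// mul1e.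
rewrite -(fineK Ifin) in GI *; move: GI; rewrite -!EFinM => -[GI].
congr EFin; rewrite powRN GI invfM -mulrA mulVf ?mulr1//.
apply: contra_neq (lt0r_neq0 (gamma_fun_gt0 k0 k1)) => I0.
by rewrite GI I0 mulr0.
Qed.

Definition gamma_law_cdf x := fine (G `]-oo, x]%classic).

Lemma gamma_law_cdfE x : (gamma_law_cdf x)%:E = G `]-oo, x]%classic.
Proof. by rewrite fineK// fin_num_measure. Qed.

Lemma gamma_cdfE x : gamma_cdf k 1 x = (gamma_law_cdf x)%:E.
Proof.
have mk : measurable_fun setT (EFin \o gamma_kernel k).
  by apply/measurable_EFinP; exact: measurable_gamma_kernel.
rewrite gamma_law_cdfE gamma_law_pos// /gamma_cdf powR1 mulr1.
rewrite (_ : _ `&` _ = `]0%R, x]%classic); last first.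
  apply/seteqP; split => y /=; rewrite !in_itv/= andbT.
    by case=> -> ->.
  by move=> /andP[].
rewrite GE// -ge0_integralZl//=; last 3 first.
- apply: measurable_funTS; apply: eq_measurable_fun mk => y _ /=.
  by rewrite /gamma_kernel divr1.
- by move=> y _; rewrite lee_fin mulr_ge0 ?powR_ge0 ?expR_ge0.
- by rewrite lee_fin invr_ge0 ltW// gamma_fun_gt0.
apply: eq_integral => y; rewrite inE/= in_itv/= => /andP[y0 _].
by rewrite gamma_density_gt0E// divr1.
Qed.

(** Here the shape matters: the power does not increase because [k <= 1], and
    the exponential decreases strictly. *)
Lemma gamma_density_lt x y : 0 < x -> x < y -> gamma_density k y < gamma_density k x.
Proof.
move=> x0 xy; have y0 := lt_trans x0 xy.
rewrite !gamma_density_gt0E// ltr_pM2l ?invr_gt0 ?gamma_fun_gt0//.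
rewrite /gamma_kernel.
apply: (@le_lt_trans _ _ (x `^ (k - 1) * expR (- y))).
  rewrite ler_wpM2r ?expR_ge0// -(opprB 1 k) !powRN lef_pV2 ?posrE ?powR_gt0//.
  by apply: ge0_ler_powR; rewrite ?nnegrE ?subr_ge0 ?(ltW x0) ?(ltW y0) ?(ltW xy).
by rewrite ltr_pM2l ?powR_gt0// ltr_expR ltrN2.
Qed.

Lemma gamma_law_cdfB x y : x <= y ->
  ((gamma_law_cdf y - gamma_law_cdf x)%:E =
   \int[mu]_(z in `]x, y]) (gamma_density k z)%:E)%E.
Proof.
move=> xy; rewrite EFinB !gamma_law_cdfE -GE//.
rewrite [X in (G X - _)%E](_ : _ = `]-oo, x] `|` `]x, y])%classic; last first.
  apply/seteqP; split => z /=; rewrite !in_itv/=.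
    by move=> zy; case: (leP z x) => zx; [left|right].
  by case=> [zx|/andP[]//]; exact: le_trans zx xy.
rewrite measureU//; last first.
  rewrite -subset0 => z [/=]; rewrite !in_itv/= => zx.
  by move=> /andP[/lt_le_trans/(_ zx)]; rewrite ltxx.
by rewrite [X in (X - _)%E]addeC addeK// fin_num_measure.
Qed.

Let EFin_mulrB_integral (r x y : R) : x <= y ->
  ((r * (y - x))%:E = \int[mu]_(z in `]x, y]) (cst r%:E) z)%E.
Proof.
move=> xy; rewrite integral_cst//= lebesgue_measure_itv/= lte_fin.
case: ifPn => [_|]; first by rewrite -EFinB -EFinM.
rewrite -leNgt => yx.
by rewrite (le_anti (introT andP (conj xy yx))) subrr mulr0 mule0.
Qed.

Lemma gamma_law_cdfB_le x y : 0 < x -> x <= y ->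
  gamma_law_cdf y - gamma_law_cdf x <= gamma_density k x * (y - x).
Proof.
move=> x0 xy; rewrite -lee_fin gamma_law_cdfB//.
rewrite EFin_mulrB_integral//.
apply: ge0_le_integral => //=.
- by move=> z _; rewrite lee_fin gamma_density_ge0.
- by apply/measurable_EFinP; apply: measurable_funTS; exact: measurable_gamma_density.
- move=> z; rewrite in_itv/= => /andP[xz _]; rewrite lee_fin ltW//.
  exact: gamma_density_lt.
Qed.

Lemma gamma_law_cdfB_ge x y : 0 <= x -> x <= y ->
  gamma_density k y * (y - x) <= gamma_law_cdf y - gamma_law_cdf x.
Proof.
move=> x0 xy; rewrite -lee_fin gamma_law_cdfB//.
rewrite EFin_mulrB_integral//.
apply: ge0_le_integral => //=.
- by move=> z _; rewrite lee_fin gamma_density_ge0.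
- by apply/measurable_EFinP; apply: measurable_funTS; exact: measurable_gamma_density.
- move=> z; rewrite in_itv/= => /andP[xz]; rewrite le_eqVlt => /predU1P[->//|zy].
  by rewrite lee_fin ltW// gamma_density_lt// (le_lt_trans x0).
Qed.

(** Bounding the density by its value at [s] on the whole interval between [s]
    and [y] only gives a weak inequality. Cutting the interval at its midpoint
    [m] makes it strict, as the densities at [m] and at [s] differ. *)
Lemma gamma_law_cdf_tangent_lt s y : 0 < s -> 0 < y -> y != s ->
  gamma_law_cdf y < gamma_law_cdf s + gamma_density k s * (y - s).
Proof.
move=> s0 y0; rewrite neq_lt => /orP[ys|sy].
- pose m := (y + s) / 2.
  have ym : y < m by rewrite /m midf_lt.
  have ms : m < s by rewrite /m midf_lt.
  have m0 : 0 < m by exact: lt_trans ym.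
  have h1 := gamma_law_cdfB_ge (ltW y0) (ltW ym).
  have h2 := gamma_law_cdfB_ge (ltW m0) (ltW ms).
  have h3 := gamma_density_lt m0 ms.
  nra.
- pose m := (s + y) / 2.
  have sm : s < m by rewrite /m midf_lt.
  have my : m < y by rewrite /m midf_lt.
  have m0 : 0 < m by exact: lt_trans sm.
  have h1 := gamma_law_cdfB_le s0 (ltW sm).
  have h2 := gamma_law_cdfB_le m0 (ltW my).
  have h3 := gamma_density_lt s0 sm.
  nra.
Qed.

Lemma gamma_law_cdf_tangent_le s y : 0 < s -> 0 < y ->
  gamma_law_cdf y <= gamma_law_cdf s + gamma_density k s * (y - s).
Proof.
move=> s0 y0; have [->|ys] := eqVneq y s; first by rewrite subrr mulr0 addr0.
exact/ltW/gamma_law_cdf_tangent_lt.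
Qed.

Section jensen.
Variables (n : nat) (w e : 'I_n -> R).
Hypotheses (n0 : (0 < n)%N) (w0 : forall i, 0 < w i) (w1 : \sum_i w i = 1).
Hypothesis e0 : forall i, 0 < e i.

Let s := \sum_i w i * e i.

Let s0 : 0 < s. Proof. exact: weighted_sum_gt0. Qed.

(** The linear terms cancel because [s] is the weighted mean of the [e i]. *)
Let tangent_sum :
  \sum_i w i * (gamma_law_cdf s + gamma_density k s * (e i - s)) =
  gamma_law_cdf s.
Proof.
under eq_bigr do rewrite mulrDr mulrCA mulrBr.
rewrite big_split/= -mulr_suml w1 mul1r -mulr_sumr sumrB -mulr_suml w1 mul1r.
by rewrite subrr mulr0 addr0.
Qed.

Let tangent_term i : w i * gamma_law_cdf (e i) <=
  w i * (gamma_law_cdf s + gamma_density k s * (e i - s)).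
Proof. by rewrite ler_pM2l//; exact: gamma_law_cdf_tangent_le. Qed.

Lemma gamma_law_cdf_jensen_le :
  \sum_i w i * gamma_law_cdf (e i) <= gamma_law_cdf s.
Proof. by rewrite -tangent_sum; apply: ler_sum => i _; exact: tangent_term. Qed.

(** If two of the [e i] differ, one of them differs from the mean [s], and its
    tangent inequality is strict. *)
Lemma gamma_law_cdf_jensen_lt i j : e i != e j ->
  \sum_i w i * gamma_law_cdf (e i) < gamma_law_cdf s.
Proof.
move=> eij; rewrite -tangent_sum.
have [l els] : exists l, e l != s.
  have [eis|] := eqVneq (e i) s; last by exists i.
  by exists j; rewrite -eis eq_sym.
rewrite (bigD1 l)//= [ltRHS](bigD1 l)//= ltr_leD//; last first.
  by apply: ler_sum => h _; exact: tangent_term.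
by rewrite ltr_pM2l//; exact: gamma_law_cdf_tangent_lt.
Qed.

End jensen.

End gamma_law.

Lemma gamma_law_cdf_measurable (R : realType)
    (G : probability (measurableTypeR R) R) :
  measurable_fun setT (gamma_law_cdf G).
Proof.
apply: nondecreasing_measurable => // x y xy.
rewrite /gamma_law_cdf fine_le ?fin_num_measure//.
apply: le_measure; rewrite ?inE// => z /=; rewrite !in_itv/= => zx.
exact: le_trans xy.
Qed.

(** * Independent exponential variables *)

Section iid_exponential.
Context {R : realType}.
Notation mu := (@lebesgue_measure R).

Lemma exponential_prob_tail (a : R) : 0 <= a ->
  (exponential_prob 1 `[a, +oo[%classic = (expR (- a))%:E)%E.
Proof.
move=> a0; rewrite /exponential_prob.
rewrite (_ : (\int[mu]_(x in _) _ = \int[mu]_(x in `[a, +oo[) (expR (- x))%:E)%E);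
  last first.
  apply: eq_integral => x; rewrite inE/= in_itv/= andbT => ax.
  by rewrite exponential_pdfE ?mul1r ?mulN1r// (le_trans a0).
have cE : continuous (fun x : R => expR (- x)).
  by move=> x; apply: continuous_comp; [exact: continuousN|exact: continuous_expR].
rewrite (@ge0_continuous_FTC2y _ _ (fun x => - expR (- x)) _ 0)//.
- by rewrite -EFinB sub0r opprK.
- exact: continuous_subspaceT.
- by rewrite -oppr0; apply: cvgN; exact: cvgr_expR.
- by apply: cvgN; apply: cvg_at_right_filter; exact: cE.
- move=> x _; rewrite derive1N// derive1_comp// derive1N// derive1_id.
  by rewrite derive1E derive_val mulrN1 opprK.
Qed.

(** The identity on the line with the exponential law, changed on the null set
    of nonpositive numbers so as to be positive everywhere: logarithms of the
    variables will be taken. *)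
Lemma positive_exponential : exists (X : probability (measurableTypeR R) R)
  (e : R -> R), [/\ measurable_fun setT e, forall x, 0 < e x &
    forall a, 0 <= a -> X [set x | a <= e x] = (expR (- a))%:E].
Proof.
have [X XE] : exists X : probability (measurableTypeR R) R,
    forall A, X A = exponential_prob 1 A.
  unshelve refine (ex_intro _ (exponential_prob 1 : probability _ _) _) => //.
pose e (x : R) := if 0 < x then x else 1.
have me : measurable_fun setT e.
  by apply: measurable_fun_ifT => //; exact: measurable_fun_ltr.
exists X, e; split => //.
  by move=> x; rewrite /e; case: ifPn.
move=> a a0; rewrite XE -exponential_prob_tail// /exponential_prob.
have mpdf : measurable_fun setT (EFin \o exponential_pdf (1 : R)).
  by apply/measurable_EFinP; exact: measurable_exponential_pdf.
(* The point 0 has to be set apart: the density does not vanish there. *)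
rewrite -(@lebesgue_integral_nonneg.integral_setD1 _ _ 0); last 2 first.
  by apply: measurableD => //; exact: measurable_superlevel.
  exact: measurable_funTS.
rewrite -[RHS](@lebesgue_integral_nonneg.integral_setD1 _ _ 0); last 2 first.
  exact: measurableD.
  exact: measurable_funTS.
rewrite integral_mkcond [RHS]integral_mkcond; apply: eq_integral => x _.
rewrite !patchE.
have [->|x0] := eqVneq x 0.
  by rewrite !memNset//= => -[_]; apply.
have [x0'|x0'] := leP x 0.
  have xlt0 : x < 0 by rewrite lt_neqAle x0.
  by rewrite !(lt0_exponential_pdf _ xlt0) !if_same.
congr (if _ then _ else _).
by apply/idP/idP; rewrite !inE/= in_itv/= andbT /e x0'.
Qed.

(** The joint tail encodes both the margins and the independence. *)
Definition iid_exponential d (Om : measurableType d) (Q : probability Om R)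
    n (E : 'I_n -> Om -> R) :=
  [/\ forall i, measurable_fun setT (E i), forall i x, 0 < E i x
    & forall a : 'I_n -> R, (forall i, 0 <= a i) ->
      Q [set x | forall i, a i <= E i x] = (expR (- \sum_i a i))%:E].

(** By induction on [n], taking the product with one more exponential law. *)
Lemma exists_iid_exponential n : exists d (Om : measurableType d)
    (Q : probability Om R) (E : 'I_n -> Om -> R), iid_exponential Q E.
Proof.
elim: n => [|n [d [Om [Q [E [mE E0 QE]]]]]].
  exists default_measure_display, unit, (\d_tt : probability unit R), (fun _ _ => 1).
  split => //.
    move=> a _; rewrite big_ord0 oppr0 expR0 (_ : [set x | _] = setT).
      exact: probability_setT.
    by apply/seteqP; split => // x _ [].
have [X [e [me e0 Xe]]] := positive_exponential.
pose E' (i : 'I_n.+1) (x : measurableTypeR R * Om) :=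
  if unlift ord0 i is Some j then E j x.2 else e x.1.
exists _, (measurableTypeR R * Om)%type, ((X \x Q)%E : probability _ R), E'; split.
- move=> i; rewrite /E'; case: unliftP => [j|] _.
    by apply: measurableT_comp; [exact: mE|exact: measurable_snd].
  by apply: measurableT_comp; [exact: me|exact: measurable_fst].
- by move=> i x; rewrite /E'; case: unliftP.
move=> a a0.
rewrite (_ : [set x | _] = [set x | a ord0 <= e x] `*`
    [set x | forall i, a (lift ord0 i) <= E i x]); last first.
  apply/seteqP; split => -[x y] /=.
    move=> h; split; first by have := h ord0; rewrite /E' unlift_none.
    by move=> i; have := h (lift ord0 i); rewrite /E' liftK.
  by move=> [h0 h] i; rewrite /E'; case: unliftP => [j|] ->.
rewrite [LHS]product_measure1E; last 2 first.
- exact: measurable_superlevel.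
- exact: measurable_upper_box.
rewrite big_ord_recl opprD expRD EFinM; congr (_ * _)%E; first exact: Xe.
exact: QE.
Qed.

Section marginals.
Context d (Om : measurableType d) (Q : probability Om R) (n : nat).
Variable E : 'I_n -> Om -> R.
Hypothesis HE : iid_exponential Q E.

Let mE i : measurable_fun setT (E i). Proof. by case: HE. Qed.
Let E0 i x : 0 < E i x. Proof. by case: HE. Qed.
Let QE (a : 'I_n -> R) : (forall i, 0 <= a i) ->
  Q [set x | forall i, a i <= E i x] = (expR (- \sum_i a i))%:E.
Proof. by case: HE => _ _; apply. Qed.

Lemma iid_exponential_tail2 i j (a b : R) : i != j -> 0 <= a -> 0 <= b ->
  Q [set x | a <= E i x /\ b <= E j x] = (expR (- (a + b)))%:E.
Proof.
move=> ij a0 b0; pose c l := if l == i then a else if l == j then b else 0.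
have c0 l : 0 <= c l by rewrite /c; case: ifP => // _; case: ifP.
have ji : (j == i) = false by rewrite eq_sym (negbTE ij).
rewrite (_ : [set x | _] = [set x | forall l, c l <= E l x]).
  rewrite QE// (bigD1 i)//= (bigD1 j) ?ji//= /c eqxx ji eqxx big1 ?addr0//.
  by move=> l /andP[/negbTE -> /negbTE ->].
apply/seteqP; split => x /=.
  move=> [ai bj] l; rewrite /c; case: eqP => [->//|_]; case: eqP => [->//|_].
  exact/ltW/E0.
by move=> h; split; [have := h i|have := h j]; rewrite /c ?ji eqxx.
Qed.

Lemma iid_exponential_tail i (a : R) : 0 <= a ->
  Q [set x | a <= E i x] = (expR (- a))%:E.
Proof.
move=> a0; pose c l := if l == i then a else 0.
have c0 l : 0 <= c l by rewrite /c; case: ifP.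
rewrite (_ : [set x | _] = [set x | forall l, c l <= E l x]).
  rewrite QE// (bigD1 i)//= /c eqxx big1 ?addr0//.
  by move=> l /negbTE ->.
apply/seteqP; split => x /=.
  by move=> ai l; rewrite /c; case: eqP => [->//|_]; exact/ltW/E0.
by move=> /(_ i); rewrite /c eqxx.
Qed.

(** The mean is the integral of the strict tails, which the weak ones bound. *)
Lemma iid_exponential_mean_le i : (\int[Q]_x (E i x)%:E <= 1)%E.
Proof.
have m_mixin := isMeasurableFun.Build _ _ _ _ _ (mE i).
pose X : {RV Q >-> R} := HB.pack (E i) m_mixin.
have -> : (\int[Q]_x (E i x)%:E = 'E_Q[X])%E by rewrite expectation_def.
rewrite ge0_expectation_ccdf; last by move=> x; exact/ltW/E0.
apply: (@le_trans _ _ (\int[mu]_(r in `[0%R, +oo[) (expR (- r))%:E)%E).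
  apply: ge0_le_integral => //=.
  - by apply: measurable_funTS; exact: ccdf_measurable.
  - by apply/measurable_EFinP/measurable_funTS; exact: measurableT_comp.
  - move=> r; rewrite in_itv/= andbT => r0.
    rewrite -(iid_exponential_tail i r0).
    apply: (@le_measure _ _ _ Q (E i @^-1` `]r, +oo[%classic)); rewrite ?inE.
    + by rewrite -[X in measurable X]setTI; exact: mE.
    + exact: measurable_superlevel.
    + by move=> x /=; rewrite in_itv/= andbT => /ltW.
rewrite (_ : (\int[mu]_(r in _) _)%E = exponential_prob 1 `[0%R, +oo[%classic).
  by rewrite exponential_prob_tail// oppr0 expR0.
apply: eq_integral => x; rewrite inE/= in_itv/= andbT => x0.
by rewrite exponential_pdfE ?mul1r ?mulN1r.
Qed.

(** If the two variables agreed almost surely, the event [2 <= E j] would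
    imply [1 <= E i] up to a null set, whence [exp (- 2) <= exp (- 3)]. *)
Lemma iid_exponential_not_ae_eq i j : i != j ->
  ~ {ae Q, forall x, E i x = E j x}.
Proof.
move=> ij [N [mN QN0 EN]].
have mS k (c : R) : measurable [set x | c <= E k x].
  exact: measurable_superlevel.
pose A := [set x | 1 <= E i x /\ 2 <= E j x].
have mA : measurable A by exact: measurableI (mS i 1) (mS j 2).
have QA : Q A = (expR (- (1 + 2)))%:E.
  exact: iid_exponential_tail2 ij ler01 (ler0n R 2).
pose B := [set x | 2 <= E j x].
have QB : Q B = (expR (- 2))%:E := iid_exponential_tail j (ler0n R 2).
have : (Q B <= Q (A `|` N))%E.
  apply: le_measure; rewrite ?inE//; [exact: mS|exact: measurableU|].
  rewrite /A /B => x /= Ej; have [Eij|Eij] := eqVneq (E i x) (E j x).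
    by left; split=> //; rewrite Eij (le_trans _ Ej)// ler1n.
  by right; apply: EN => /= /eqP; rewrite (negbTE Eij).
have -> : Q (A `|` N) = Q A by exact: measureU0.
by rewrite QA QB lee_fin ler_expR lerN2 gerDr ler10.
Qed.

End marginals.
End iid_exponential.

(** * Joint laws are determined by joint tails *)

Section joint_law.
Context {R : realType} (n : nat).

(** These sets generate the sigma-algebra put on the space of vectors; they
    are stable under intersection, as required by the uniqueness of measures. *)
Definition upper_orthants : set (set ('I_n -> R)) :=
  [set A | exists a, A = [set v | forall i, a i <= v i]].

Notation orthant_space := (g_sigma_algebraType upper_orthants).

Lemma setI_closed_upper_orthants : setI_closed upper_orthants.
Proof.
move=> _ _ [a ->] [b ->]; exists (fun i => Num.max (a i) (b i)).
apply/seteqP; split => v /=; first by move=> [va vb] i; rewrite ge_max va vb.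
by move=> h; split => i; have := h i; rewrite ge_max => /andP[].
Qed.

Let nat_lower_bound (v : 'I_n -> R) : exists k : nat, forall i, - k%:R <= v i.
Proof.
exists (\max_(j < n) Num.bound `|v j|%R)%N => i.
rewrite lerNl; apply: (le_trans (ler_norm _)); rewrite normrN.
apply/ltW/(lt_le_trans (archi_boundP (normr_ge0 _))).
by rewrite ler_nat (bigD1 i)//= leq_maxl.
Qed.

(** A half-space is the union of the orthants whose other bounds are [- k],
    for all natural numbers [k]. *)
Lemma measurable_orthant_coord i :
  measurable_fun setT (fun v : orthant_space => v i : R).
Proof.
apply: (measurability (@RGenCInfty.G R)); first exact: RGenCInfty.measurableE.
move=> _ [_ [a ->] <-]; rewrite setTI.
rewrite (_ : _ @^-1` _ = \bigcup_k [set v : orthant_space |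
    forall j, (if j == i then a else - k%:R) <= v j]); last first.
  apply/seteqP; split => [v|v [k _]] /=; rewrite in_itv/= andbT; last first.
    by move/(_ i); rewrite eqxx.
  move=> va; have [k kv] := nat_lower_bound v.
  by exists k => // j /=; case: eqP => [->|_].
apply: bigcupT_measurable => k; apply: sub_sigma_algebra.
by exists (fun j => if j == i then a else - k%:R).
Qed.

Lemma measurable_orthant_map d (T : measurableType d) (X : 'I_n -> T -> R) :
  (forall i, measurable_fun setT (X i)) ->
  measurable_fun setT (fun x => (fun i => X i x) : orthant_space).
Proof.
move=> mX; apply: (@measurability _ _ T orthant_space setT _ upper_orthants) => //.
move=> _ [_ [a ->] <-]; rewrite setTI.
exact: (measurable_upper_box a mX).
Qed.

(** The two image laws agree on the orthants, hence on the sigma-algebra that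
    they generate, for which a sum of measurable functions of the coordinates
    is measurable. *)
Lemma joint_law_unique d1 (T1 : measurableType d1) (P1 : probability T1 R)
    d2 (T2 : measurableType d2) (P2 : probability T2 R)
    (X : 'I_n -> T1 -> R) (Y : 'I_n -> T2 -> R) :
  (forall i, measurable_fun setT (X i)) -> (forall i, measurable_fun setT (Y i)) ->
  (forall a : 'I_n -> R,
    P1 [set x | forall i, a i <= X i x] = P2 [set x | forall i, a i <= Y i x]) ->
  forall (h : 'I_n -> R -> R) (c : R), (forall i, measurable_fun setT (h i)) ->
  P1 [set x | c <= \sum_i h i (X i x)] = P2 [set x | c <= \sum_i h i (Y i x)].
Proof.
move=> mX mY XY h c mh.
have mX' := isMeasurableFun.Build _ _ _ _ _ (measurable_orthant_map mX).
pose FX : {RV P1 >-> orthant_space} :=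
  HB.pack (fun x => (fun i => X i x) : orthant_space) mX'.
have mY' := isMeasurableFun.Build _ _ _ _ _ (measurable_orthant_map mY).
pose FY : {RV P2 >-> orthant_space} :=
  HB.pack (fun x => (fun i => Y i x) : orthant_space) mY'.
have lawE A : measurable A -> distribution P1 FX A = distribution P2 FY A.
  apply: (@measure_unique _ R orthant_space upper_orthants
    (fun k => [set v | forall i, - k%:R <= v i])) => //.
  - exact: setI_closed_upper_orthants.
  - by move=> k; exists (fun=> - k%:R).
  - apply/seteqP; split => // v _.
    by have [k kv] := nat_lower_bound v; exists k.
  - by move=> _ [a ->]; exact: XY.
  - by move=> k; rewrite (le_lt_trans (probability_le1 _ _)) ?ltry//;
      apply: sub_sigma_algebra; exists (fun=> - k%:R).
have := lawE [set v | c <= \sum_i h i (v i)]; apply.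
apply: (@measurable_superlevel _ orthant_space); apply: measurable_sum => i.
by apply: measurableT_comp; [exact: mh|exact: measurable_orthant_coord].
Qed.

End joint_law.

(** * The frailty representation of the Clayton copula *)

Lemma uniform_prob_le (R : realType) (p : R) : 0 < p -> p <= 1 ->
  uniform_prob (@ltr01 R) `]-oo, p]%classic = p%:E.
Proof.
move=> p0 p1; rewrite /uniform_prob integral_uniform_pdf.
rewrite (_ : _ `&` _ = `[0, p]%classic); last first.
  apply/seteqP; split => x /=; rewrite !in_itv/=.
    by move=> [xp /andP[-> _]].
  by move=> /andP[x0 xp]; rewrite x0 xp (le_trans xp).
rewrite (eq_integral (cst 1%E)); last first.
  move=> x; rewrite inE/= in_itv/= => /andP[x0 xp].
  by rewrite /uniform_pdf x0 (le_trans xp p1) subr0 invr1.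
by rewrite integral_cst//= lebesgue_measure_itv/= lte_fin p0 mul1e sube0.
Qed.

Lemma uniform_prob_outside (R : realType) :
  uniform_prob (@ltr01 R) (~` `]0, 1[%classic) = 0.
Proof.
rewrite /uniform_prob integral_uniform_pdf.
have -> : ~` `]0, 1[ `&` `[0, 1] = [set (0 : R)] `|` [set 1].
  apply/seteqP; split => x /=; rewrite !in_itv/=.
    move=> [/negP + /andP[x0 x1]]; rewrite !lt_neqAle x0 x1 !andbT negb_and !negbK.
    by rewrite eq_sym => /orP[/eqP|/eqP]; [left|right].
  by case=> ->; rewrite ?ltxx ?andbF ?lexx ?ler01.
rewrite ge0_integral_setU//=.
- by rewrite !integral_set1 adde0.
- by apply: measurable_funTS; apply/measurable_EFinP; exact: measurable_uniform_pdf.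
- by move=> x _; rewrite lee_fin uniform_pdf_ge0// ltr01.
- by apply/disj_setPS => x [/= ->] /eqP; rewrite eq_sym oner_eq0.
Qed.

(** The copula formula does not cover these points, which form a null set
    because the margins are uniform. *)
Definition outside_cube (T : Type) (R : realType) n (U : 'I_n -> T -> R) : set T :=
  [set x | exists i, ~~ (0 < U i x < 1)].

Lemma not_outside_cube (T : Type) (R : realType) n (U : 'I_n -> T -> R) x :
  ~ outside_cube U x -> forall i, 0 < U i x < 1.
Proof. by move=> Nx i; apply: contrapT => /negP h; apply: Nx; exists i. Qed.

Section clayton_vector.
Context d (T : measurableType d) (R : realType) (P : probability T R).
Variables (n : nat) (t : R) (U : 'I_n -> {RV P >-> R}).
Hypotheses (t1 : 1 <= t) (HU : has_copula (@clayton R n t) U).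

Let t0 : 0 < t. Proof. exact: lt_le_trans t1. Qed.

Local Notation cube_exit := (outside_cube (fun i => U i : T -> R)).

Let cube_exitE :
  cube_exit = \big[setU/set0]_(i in 'I_n) U i @^-1` (~` `]0, 1[%classic).
Proof.
rewrite -bigcup_pred; apply/seteqP; split => x /= [i].
  by move=> h; exists i => //=; rewrite in_itv/=; exact/negP.
by move=> _ /=; rewrite in_itv/= => /negP h; exists i.
Qed.

Let outside_cube_measurable_null : measurable cube_exit /\ P cube_exit = 0.
Proof.
rewrite cube_exitE; elim/big_ind : _ => // [A B [mA A0] [mB B0]|i _].
  by split; [exact: measurableU|exact: null_set_setU].
split; first by rewrite -[X in measurable X]setTI; apply: measurable_funP => //;
  exact: measurableC.
have [marg _] := HU; rewrite -(uniform_prob_outside R) -(marg i)//.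
exact: measurableC.
Qed.

Lemma measurable_outside_cube : measurable cube_exit.
Proof. by case: outside_cube_measurable_null. Qed.

Lemma outside_cube_null : P cube_exit = 0.
Proof. by case: outside_cube_measurable_null. Qed.

Local Notation V := (fun i x => U i x `^ (- t) - 1).

Lemma measurable_clayton_excess i : measurable_fun setT (V i).
Proof.
apply: measurable_funB => //.
by apply: (@measurableT_comp _ _ _ _ _ _ (fun y : R => y `^ (- t)) _ (U i)).
Qed.

Lemma clayton_excess_ge i x c : 0 < U i x < 1 -> 0 < c ->
  (c <= V i x) = (U i x <= (1 + c) `^ (- t^-1)).
Proof.
move=> /andP[u0 u1] c0; rewrite lerBrDl.
have c1 : 0 < 1 + c by rewrite addr_gt0.
set v := _ `^ (- t^-1); have v0 : 0 < v by rewrite powR_gt0.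
have -> : 1 + c = v `^ (- t).
  by rewrite -powRrM mulrNN mulVf ?gt_eqF// powRr1// ltW.
by rewrite !powRN lef_pV2 ?posrE ?powR_gt0// ler_powR_base.
Qed.

(** The logarithm of [U i x ^ (- t) - 1] takes all real values when [U i x]
    ranges over the open unit interval, so that the copula formula gives the
    tail at every [a], without boundary cases. *)
Lemma clayton_log_tail (a : 'I_n -> R) :
  P [set x | forall i, a i <= ln (V i x)] =
  ((1 + \sum_i expR (a i)) `^ (- t^-1))%:E.
Proof.
pose v i := (1 + expR (a i)) `^ (- t^-1).
have e1 i : 1 < 1 + expR (a i) by rewrite ltrDl expR_gt0.
have v01 i : 0 < v i < 1.
  have e0 := lt_trans ltr01 (e1 i).
  rewrite powR_gt0//= /v powRN invf_lt1 ?powR_gt0//.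
  have k0 : 0 < t^-1 by rewrite invr_gt0.
  have := ler_powR_base k0 e0 ltr01.
  by rewrite powR1 [X in _ = X]leNgt (e1 i) ltNge => ->.
have [_ /(_ v v01) vE] := HU.
transitivity ((clayton t v)%:E); last first.
  rewrite /clayton; congr (_ `^ _)%:E.
  rewrite (eq_bigr (fun i => 1 + expR (a i))); last first.
    by move=> i _; rewrite /v -powRrM mulrNN mulVf ?gt_eqF// powRr1.
  by rewrite big_split/= sumr_const card_ord; ring.
rewrite -vE.
apply: (eq_measure_off_null _ _ measurable_outside_cube outside_cube_null).
- apply: measurable_upper_box => i; apply: measurableT_comp => //.
  exact: measurable_clayton_excess.
- rewrite (_ : [set x | _] = [set x | forall i, - v i <= - U i x]).
    apply: measurable_upper_box => i.
    exact: measurable_funN.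
  by apply/seteqP; split => x /= h i; have := h i; rewrite lerN2.
move=> x Nx /=; have Ux := not_outside_cube Nx.
have iE i : (a i <= ln (V i x)) = (U i x <= v i).
  rewrite -clayton_excess_ge// ?expR_gt0//.
  by rewrite -[LHS]ler_expR lnK// posrE subr_gt0 powRN_gt1.
by split => h i; have := h i; rewrite iE.
Qed.

Section frailty.
Context dO (Om : measurableType dO) (Q : probability Om R).
Variables (E : 'I_n -> Om -> R) (G : probability (measurableTypeR R) R).
Hypotheses (HE : iid_exponential Q E) (GE : gamma_law t^-1 G).

Let mE i : measurable_fun setT (E i). Proof. by case: HE. Qed.
Let E0 i x : 0 < E i x. Proof. by case: HE. Qed.
Let k0 : 0 < t^-1. Proof. by rewrite invr_gt0. Qed.
Let k1 : t^-1 <= 1. Proof. by rewrite invf_le1. Qed.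

(** A Gamma variable is only positive almost surely; [pos] makes it positive
    everywhere without changing its law. *)
Let pos (g : R) := if 0 < g then g else 1.
Let Y i (z : Om * measurableTypeR R) := ln (E i z.1) - ln (pos z.2).

Let pos_gt0 g : 0 < pos g. Proof. by rewrite /pos; case: ifPn. Qed.

Let measurable_pos : measurable_fun setT pos.
Proof. by apply: measurable_fun_ifT => //; exact: measurable_fun_ltr. Qed.

Let measurable_Y i : measurable_fun setT (Y i).
Proof.
apply: measurable_funB; apply: measurableT_comp => //; apply: measurableT_comp.
- exact: mE.
- exact: measurable_fst.
- exact: measurable_pos.
- exact: measurable_snd.
Qed.

Let Y_ge i z a : (a <= Y i z) = (pos z.2 * expR a <= E i z.1).
Proof.
by rewrite lerBrDl -[LHS]ler_expR expRD !lnK ?posrE.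
Qed.

Let G_nonpos : G `]-oo, 0]%classic = 0.
Proof.
rewrite (gamma_law_pos GE)// (_ : _ `&` _ = set0) ?measure0//.
by rewrite -subset0 => x [/=]; rewrite !in_itv/= andbT leNgt => /negP.
Qed.

(** Conditionally on the Gamma variable [y], the tail is [exp (- y * c)] with
    [c] the sum of the [exp (a i)]; its mean is the Laplace transform at [c]. *)
Lemma frailty_log_tail (a : 'I_n -> R) :
  (Q \x G)%E [set z | forall i, a i <= Y i z] =
  ((1 + \sum_i expR (a i)) `^ (- t^-1))%:E.
Proof.
set A := [set z | _].
have mA : measurable A by exact: measurable_upper_box.
have -> : (Q \x G)%E A = (Q \x^ G)%E A.
  apply: product_measure_unique => // B C mB mC.
  exact: product_measure2E.
rewrite -(gamma_law_laplace k0 k1 GE); last first.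
  by apply: sumr_ge0 => i _; exact: expR_ge0.
transitivity (\int[G]_y (expR (- ((\sum_i expR (a i)) * pos y)))%:E)%E.
  apply: eq_integral => y _ /=.
  rewrite -[RHS](_ : Q [set x | forall i, pos y * expR (a i) <= E i x] = _);
    last first.
    have [_ _ QE] := HE.
    rewrite QE; last by move=> i; rewrite mulr_ge0 ?expR_ge0// ltW.
    by rewrite -mulr_sumr mulrC.
  congr (Q _); apply/seteqP; split => x /=.
    by rewrite /ysection/= inE => h i; have := h i; rewrite Y_ge.
  by move=> h; rewrite /ysection/= inE => i; rewrite Y_ge; exact: h.
apply: ge0_ae_eq_integral => //.
- apply/measurable_EFinP; apply: measurableT_comp => //.
  apply: measurableT_comp => //.
  by apply: measurable_funM => //; exact: measurable_pos.
- apply/measurable_EFinP; apply: measurableT_comp => //.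
  by apply: measurableT_comp => //; exact: mulrl_measurable.
exists `]-oo, 0]%classic; split => //.
move=> y /= ; rewrite in_itv/= => /not_implyP[_]; apply: contra_notT.
by rewrite -ltNge /pos => ->.
Qed.

(** The vectors of logarithms have the same joint tails, hence the same law.
    Conditioning is now on the exponential variables: given them, the event
    bounds the Gamma variable by [(\sum_i c i * E i) / x]. *)
Lemma clayton_frailty (c : 'I_n -> R) (x : R) : 0 < x ->
  P [set z | x <= \sum_i c i * (U i z `^ (- t) - 1)] =
  (\int[Q]_o (gamma_law_cdf G ((\sum_i c i * E i o) / x))%:E)%E.
Proof.
move=> x0; pose h i (v : R) := c i * expR v.
have mh i : measurable_fun setT (h i).
  by apply: measurable_funM => //; exact: measurable_expR.
have mlnV i : measurable_fun setT (fun z => ln (V i z)).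
  by apply: measurableT_comp => //; exact: measurable_clayton_excess.
have := joint_law_unique (P1 := P) (P2 := (Q \x G)%E)
  (X := fun i z => ln (V i z)) (Y := Y) mlnV measurable_Y.
move=> /(_ _ h x mh) => law.
transitivity (P [set z | x <= \sum_i h i (ln (V i z))]).
  apply: (eq_measure_off_null _ _ measurable_outside_cube outside_cube_null).
  - apply: measurable_superlevel; apply: measurable_sum => i.
    by apply: measurable_funM => //; exact: measurable_clayton_excess.
  - apply: measurable_superlevel; apply: measurable_sum => i.
    by apply: measurableT_comp; [exact: mh|exact: mlnV].
  move=> z Nz /=.
  rewrite (eq_bigr (fun i => h i (ln (V i z))))// => i _.
  rewrite /h lnK// posrE subr_gt0 powRN_gt1//.
  exact: (not_outside_cube Nz i).
rewrite law; last first.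
  by move=> a; apply: etrans (clayton_log_tail a) (esym (frailty_log_tail a)).
apply: eq_integral => o _ /=; rewrite gamma_law_cdfE.
set s := \sum_i c i * E i o.
have mS : measurable [set g : measurableTypeR R | x <= s / pos g].
  rewrite (_ : [set g | _] = [set g | x * pos g <= s]); last first.
    by apply/seteqP; split => g /=; rewrite ler_pdivlMr.
  apply: measurable_sublevel.
  by apply: measurableT_comp => //; exact: mulrl_measurable.
rewrite (_ : xsection _ _ = [set g | x <= s / pos g]); last first.
  have hE g : \sum_i h i (Y i (o, g)) = s / pos g.
    rewrite /s mulr_suml; apply: eq_bigr => i _.
    by rewrite /h /Y expRD expRN !lnK ?posrE// mulrA.
  apply/seteqP; split => g /=; first by rewrite /xsection /= inE /= hE.
  by move=> gs; rewrite /xsection /= inE /= hE.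
rewrite (gamma_law_pos GE mS) [RHS](gamma_law_pos GE)//; congr (G _).
by apply/seteqP; split => g /=; rewrite !in_itv/= !andbT => -[gs g0]; move: gs;
  rewrite /pos g0 ler_pdivlMr// ler_pdivlMr// mulrC.
Qed.

End frailty.

End clayton_vector.

(** * Weighted power means of a Clayton vector *)

Section clayton_mean.
Context d (T : measurableType d) (R : realType) (P : probability T R).
Variables (n : nat) (t : R) (w : 'I_n -> R) (U : 'I_n -> {RV P >-> R}).
Hypotheses (n2 : (2 <= n)%N) (t1 : 1 <= t).
Hypotheses (w0 : forall i, 0 < w i) (w1 : \sum_(i < n) w i = 1).
Hypothesis HU : has_copula (@clayton R n t) U.

Let n0 : (0 < n)%N. Proof. exact: ltnW. Qed.
Let t0 : 0 < t. Proof. exact: lt_le_trans t1. Qed.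
Let k0 : 0 < t^-1. Proof. by rewrite invr_gt0. Qed.
Let k1 : t^-1 <= 1. Proof. by rewrite invf_le1. Qed.

Local Notation mean r x := (weighted_mean w (- r) (fun i => U i x)).

Lemma measurable_mean r : measurable_fun setT (fun x => mean r x).
Proof.
apply: (@measurableT_comp _ _ _ _ _ _ (fun y : R => y `^ (- r)^-1)).
  exact: measurable_powR.
apply: measurable_sum => i; apply: measurable_funM => //.
exact: (@measurableT_comp _ _ _ _ _ _ (fun y : R => y `^ (- r)) _ (U i)).
Qed.

Lemma prob_mean_nondecreasing (s r p : R) : 0 < s -> s <= r ->
  (P [set x | (mean s x <= p)%R] <= P [set x | (mean r x <= p)%R])%E.
Proof.
move=> s0 sr.
apply: (le_measure_off_null _ _ (measurable_outside_cube HU) (outside_cube_null HU)).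
- by apply: measurable_sublevel; exact: measurable_mean.
- by apply: measurable_sublevel; exact: measurable_mean.
move=> x [/= xp Nx]; apply: le_trans xp; apply: weighted_mean_nincr => // i.
by have /andP[] := not_outside_cube Nx i.
Qed.

Lemma prob_mean_t (p : R) : 0 < p ->
  P [set x | mean t x <= p] =
  P [set x | p `^ (- t) - 1 <= \sum_i w i * (U i x `^ (- t) - 1)].
Proof.
move=> p0.
apply: (eq_measure_off_null _ _ (measurable_outside_cube HU) (outside_cube_null HU)).
- by apply: measurable_sublevel; exact: measurable_mean.
- apply: measurable_superlevel; apply: measurable_sum => i.
  by apply: measurable_funM => //; exact: measurable_clayton_excess.
move=> x Nx /=; rewrite weighted_mean_le// => i.
by have /andP[] := not_outside_cube Nx i.
Qed.

Lemma prob_marginal (p : R) i : 0 < p < 1 ->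
  P [set x | p `^ (- t) - 1 <= U i x `^ (- t) - 1] = p%:E.
Proof.
move=> /andP[p0 p1]; have [marg _] := HU.
rewrite -(uniform_prob_le p0 (ltW p1)) -(marg i)//.
apply: (eq_measure_off_null _ _ (measurable_outside_cube HU) (outside_cube_null HU)).
- by apply: measurable_superlevel; exact: measurable_clayton_excess.
- by rewrite -[X in measurable X]setTI; exact: measurable_funP.
move=> x Nx /=; rewrite in_itv/=.
have /andP[u0 _] := not_outside_cube Nx i.
by rewrite lerD2r !powRN lef_pV2 ?posrE ?powR_gt0// ler_powR_base.
Qed.

Let level_gt0 p : 0 < p < 1 -> 0 < p `^ (- t) - 1.
Proof. by move=> p01; rewrite subr_gt0 powRN_gt1. Qed.

(** Jensen's inequality in the space of indices, strict on the event that the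
    first two exponential variables differ, which is not null. *)
Lemma prob_mean_gt (p : R) : 0 < p < 1 -> (p%:E < P [set x | (mean t x <= p)%R])%E.
Proof.
move=> p01; have /andP[p0 p1] := p01.
have [dO [Om [Q [E HE]]]] := exists_iid_exponential (R := R) n.
have [mE E0 _] := HE.
have [G GE] := gamma_law_exists k0 k1.
have c0 := level_gt0 p01; set c := p `^ (- t) - 1 in c0.
have frailty := clayton_frailty t1 HU HE GE.
have mF := gamma_law_cdf_measurable G.
have F0 y : 0 <= gamma_law_cdf G y by exact: fine_ge0.
have mFE (e : Om -> R) : measurable_fun setT e ->
    measurable_fun setT (fun o => gamma_law_cdf G (e o / c)).
  move=> me; apply: measurableT_comp => //.
  by apply: measurable_funM.
(* The representation with all the weight on the index [i], read from right to
   left. *)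
have marg i : (\int[Q]_o (gamma_law_cdf G (E i o / c))%:E = p%:E)%E.
  have := frailty (fun j => (j == i)%:R) c c0.
  have sumE (v : 'I_n -> R) : \sum_j (j == i)%:R * v j = v i.
    rewrite (bigD1 i)//= eqxx mul1r big1 ?addr0// => j /negbTE ->.
    by rewrite mul0r.
  under eq_integral do rewrite sumE.
  move=> <-; under eq_set do rewrite sumE.
  exact: prob_marginal.
have margsum : (\int[Q]_o (\sum_i w i * gamma_law_cdf G (E i o / c))%:E = p%:E)%E.
  under eq_integral do rewrite -sumEFin.
  rewrite ge0_integral_sum//; last 2 first.
    by move=> i; apply/measurable_EFinP; apply: measurable_funM => //; exact: mFE.
    by move=> i o _; rewrite lee_fin mulr_ge0// ltW.
  rewrite (eq_bigr (fun i => (w i * p)%:E)); last first.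
    move=> i _; under eq_integral do rewrite EFinM.
    rewrite ge0_integralZl//; last 3 first.
    - by apply/measurable_EFinP; exact: mFE.
    - by move=> o _; rewrite lee_fin.
    - by rewrite lee_fin ltW.
    by rewrite marg -EFinM.
  by rewrite sumEFin -mulr_suml w1 mul1r.
have sumdiv o : (\sum_i w i * E i o) / c = \sum_i w i * (E i o / c).
  by rewrite mulr_suml; apply: eq_bigr => i _; rewrite mulrA.
rewrite prob_mean_t// -/c frailty//.
under eq_integral do rewrite sumdiv.
rewrite -[X in (X < _)%E]margsum.
have Ec0 o i : 0 < E i o / c by rewrite divr_gt0.
have jensen_le o := gamma_law_cdf_jensen_le k0 k1 GE n0 w0 w1 (Ec0 o).
have jensen_lt o := gamma_law_cdf_jensen_lt k0 k1 GE n0 w0 w1 (Ec0 o).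
apply: lt_integral.
- apply: measurable_sum => i; apply: measurable_funM => //; exact: mFE.
- apply: measurableT_comp => //; apply: measurable_sum => i.
  by apply: measurable_funM => //; exact: measurable_funM.
- by move=> o; apply: sumr_ge0 => i _; rewrite mulr_ge0// ltW.
- by move=> o; exact: jensen_le.
- by rewrite margsum ltry.
pose i0 : 'I_n := Ordinal n0; pose i1 : 'I_n := Ordinal n2.
move=> aeq; apply: (iid_exponential_not_ae_eq HE (isT : i0 != i1)).
apply: filterS aeq => o eqo; apply/eqP/negPn/negP => neq.
have /mulIf cI : c^-1 != 0 by rewrite invr_neq0// gt_eqF.
by have := jensen_lt o i0 i1; rewrite eqo ltxx (inj_eq cI) neq => /(_ isT).
Qed.

(** Jensen's inequality for the expectation, in the form of the tangent line
    of the distribution function at the mean of [S / c], which is at most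
    [c^-1]. *)
Lemma prob_mean_le (p : R) : 0 < p < 1 ->
  (P [set x | (mean t x <= p)%R] <= gamma_cdf t^-1 1 (p `^ (- t) - 1)^-1)%E.
Proof.
move=> p01; have /andP[p0 p1] := p01.
have [dO [Om [Q [E HE]]]] := exists_iid_exponential (R := R) n.
have [mE E0 _] := HE.
have [G GE] := gamma_law_exists k0 k1.
have c0 := level_gt0 p01; set c := p `^ (- t) - 1 in c0 *.
rewrite prob_mean_t// -/c (clayton_frailty t1 HU HE GE)//.
rewrite (gamma_cdfE k0 k1 GE).
have m0 : 0 < c^-1 by rewrite invr_gt0.
set m := c^-1; pose f := gamma_density t^-1 m.
have f0 : 0 <= f by exact: gamma_density_ge0.
have mF := gamma_law_cdf_measurable G.
have F0 y : 0 <= gamma_law_cdf G y by exact: fine_ge0.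
pose S o := \sum_i w i * E i o.
have mS : measurable_fun setT S.
  by apply: measurable_sum => i; exact: measurable_funM.
have S0 o : 0 < S o by apply: weighted_sum_gt0.
have mFS : measurable_fun setT (fun o => gamma_law_cdf G (S o / c)).
  by apply: measurableT_comp => //; exact: measurable_funM.
have intS : (\int[Q]_o (S o)%:E <= 1)%E.
  under eq_integral do rewrite -sumEFin.
  rewrite ge0_integral_sum//; last 2 first.
    by move=> i; apply/measurable_EFinP; exact: measurable_funM.
    by move=> i o _; rewrite lee_fin ltW// mulr_gt0.
  rewrite -[leRHS]/(1%:E) -w1 -sumEFin; apply: lee_sum => i _.
  under eq_integral do rewrite EFinM.
  rewrite ge0_integralZl//; last 3 first.
    exact/measurable_EFinP.
    by move=> o _; rewrite lee_fin ltW.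
    by rewrite lee_fin ltW.
  rewrite -[leRHS]mule1 lee_wpmul2l ?lee_fin ?(ltW (w0 i))//.
  exact: (iid_exponential_mean_le HE).
have tangent o : gamma_law_cdf G (S o / c) + f * m <= gamma_law_cdf G m + f * m * S o.
  have Sc0 : 0 < S o / c by rewrite divr_gt0.
  have := gamma_law_cdf_tangent_le k0 k1 GE m0 Sc0.
  by rewrite -/f -/m; lra.
have intc (r : R) : (\int[Q]_o r%:E = r%:E)%E.
  rewrite (integral_cst Q measurableT) -[RHS]mule1; congr (_ * _)%E.
  exact: probability_setT.
(* Adding [f * m] to both sides makes all the integrands nonnegative. *)
rewrite -(leeD2rE (x := (f * m)%:E))//.
have fm0 : 0 <= f * m by rewrite mulr_ge0// ltW.
have -> : (\int[Q]_o (gamma_law_cdf G (S o / c))%:E + (f * m)%:E =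
    \int[Q]_o (gamma_law_cdf G (S o / c) + f * m)%:E)%E.
  under [RHS]eq_integral do rewrite EFinD.
  rewrite ge0_integralD//; last 2 first.
  - by move=> o _; rewrite lee_fin.
  - exact/measurable_EFinP.
  by rewrite intc.
apply: (@le_trans _ _ (\int[Q]_o (gamma_law_cdf G m + f * m * S o)%:E)%E).
  apply: ge0_le_integral => //.
  - by move=> o _; rewrite lee_fin addr_ge0.
  - by apply/measurable_EFinP; exact: measurable_funD.
  - apply/measurable_EFinP; apply: measurable_funD => //.
    exact: measurable_funM.
  - by move=> o _; rewrite lee_fin.
under eq_integral do rewrite EFinD.
rewrite ge0_integralD//; last 3 first.
- by move=> o _; rewrite lee_fin.
- by move=> o _; rewrite lee_fin mulr_ge0// ltW.
- by apply/measurable_EFinP; exact: measurable_funM.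
rewrite intc leeD2l//.
under eq_integral do rewrite EFinM.
rewrite ge0_integralZl//; last 2 first.
- exact/measurable_EFinP.
- by move=> o _; rewrite lee_fin ltW.
by rewrite -[leRHS]mule1 lee_wpmul2l// lee_fin.
Qed.

End clayton_mean.

Theorem theorem2 (d : measure_display) (T : measurableType d) (R : realType)
    (P : probability T R) (n : nat) (t : R) (w : 'I_n -> R)
    (U : 'I_n -> {RV P >-> R}) :
  (2 <= n)%N -> 1 <= t -> @open_simplex R n w ->
  has_copula (@clayton R n t) U ->
  [/\ forall r : R, t <= r ->
        strictly_subuniform P
          (fun x => weighted_mean w (- r) (fun i => U i x)),
      forall p s : R, 0 < p < 1 -> 1 <= s <= t ->
        (P [set x | (weighted_mean w (- s) (fun i => U i x) <= p)%R]
         <= gamma_cdf t^-1 1 (p `^ (- t) - 1)^-1)%E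
    & forall p : R, 0 < p < 1 ->
        (P [set x | (weighted_mean w (- 1) (fun i => U i x) <= p)%R]
         <= ereal_sup [set gamma_cdf b^-1 1 (p `^ (- b) - 1)^-1
                      | b in [set b : R | (1 <= b)%R]])%E].
Proof.
move=> n2 t1 [[_ w1] w01] HU.
have w0 i : 0 < w i by have /andP[] := w01 i.
have t0 : 0 < t by exact: lt_le_trans t1.
have bound (p s : R) : 0 < p < 1 -> 1 <= s <= t ->
    (P [set x | (weighted_mean w (- s) (fun i => U i x) <= p)%R]
     <= gamma_cdf t^-1 1 (p `^ (- t) - 1)^-1)%E.
  move=> p01 /andP[s1 st].
  apply: le_trans (prob_mean_le n2 t1 w0 w1 HU p01).
  apply: (prob_mean_nondecreasing n2 w0 w1 HU _ _ st).
  exact: lt_le_trans ltr01 s1.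
split => // [r tr|p p01].
- split.
  + exact: measurable_mean.
  + by move=> x; exact: powR_ge0.
  + move=> p p01; apply: lt_le_trans (prob_mean_gt n2 t1 w0 w1 HU p01) _.
    exact: (prob_mean_nondecreasing n2 w0 w1 HU _ t0 tr).
- apply: le_trans (bound p 1 p01 _) _; first by rewrite lexx.
  by apply: ereal_sup_ubound; exists t.
Qed.
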